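(* Let $(\tau_1,\tau_2)$ be a $\operatorname{CDPH}(\bm{\alpha},\bm{P},\bm{U},\bm{Q}_1,\bm{Q}_2)$ random vector. Then the sum $\tau_1+\tau_2$ follows a DPH distribution.
   Context: CDPH. $\mathcal{E}$ and $\mathcal{S}$ are disjoint nonempty finite sets. $\bm{\alpha}$ is a probability row vector indexed by $\mathcal{E}$; $\bm{P}$ is a subprobability matrix (nonnegative entries, row sums at most $1$) on $\mathcal{E}$; $\bm{U}$ is a nonnegative $\mathcal{E}\times\mathcal{S}$ matrix such that each row of $(\bm{P}\ \bm{U})$ sums to one; $\bm{Q}_1,\bm{Q}_2$ are subprobability matrices on $\mathcal{S}$. All chains terminate almost surely (from every state), i.e. all eigenvalues of $\bm{P},\bm{Q}_1,\bm{Q}_2$ have modulus strictly less than $1$. $M_1$ is a terminating Markov chain (time $n=0,1,2,\dots$) on $\mathcal{E}\cup\mathcal{S}$ with initial vector $(\bm{\alpha},\bm{0})$ and subprobability transition matrix $\begin{pmatrix}\bm{P}&\bm{U}\\ \bm{0}&\bm{Q}_1\end{pmatrix}$ (the missing mass in a row is the probability of terminating at the next step). Let $\tau_{1,2}:=\inf\{n\ge 1: M_1(n)\notin\mathcal{E}\}$. Set $M_2(n)=M_1(n)$ for $n\le\tau_{1,2}$; after time $\tau_{1,2}$, given the past up to $\tau_{1,2}$, $M_2$ evolves independently of $M_1$ as a terminating Markov chain in $\mathcal{S}$ with subprobability matrix $\bm{Q}_2$. For $k\in\{1,2\}$, $\tau_k:=\inf\{n\ge 1: M_k(n)\notin\mathcal{E}\cup\mathcal{S}\}$.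 The law of $(\tau_1,\tau_2)$ is called $\operatorname{CDPH}(\bm{\alpha},\bm{P},\bm{U},\bm{Q}_1,\bm{Q}_2)$. A DPH (discrete phase-type) distribution is the law of the termination time $\inf\{n\ge1: M(n)\text{ has terminated}\}$ of an almost surely terminating Markov chain $M$ on some finite state space, with some initial probability vector and some subprobability transition matrix. *)

(* Defs.v *)
From HB Require Import structures.
From mathcomp Require Import all_boot all_order all_algebra.
From mathcomp Require Import all_classical all_reals all_analysis.
From mathcomp Require Import measurable_realfun.
From mathcomp Require Import complex.

Set Implicit Arguments.
Unset Strict Implicit.
Unset Printing Implicit Defensive.

Import Order.TTheory GRing.Theory Num.Theory.
Import numFieldNormedType.Exports.

Local Open Scope classical_set_scope.
Local Open Scope ring_scope.

(* Vectors and matrices indexed by finite sets are functions on finTypes. *)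

Definition probability_vector (R : realType) (S : finType) (a : S -> R) : Prop :=
  (forall x, 0 <= a x) /\ \sum_x a x = 1.

Definition subprobability_matrix (R : realType) (S : finType)
    (A : S -> S -> R) : Prop :=
  (forall x y, 0 <= A x y) /\ (forall x, \sum_y A x y <= 1).

(* Reindexing along enum_val conjugates by a permutation, so the eigenvalues
   do not depend on the enumeration of S. *)
Definition complex_matrix (R : realType) (S : finType) (A : S -> S -> R) :
    'M[R[i]]_#|S| :=
  \matrix_(i, j) (A (enum_val i) (enum_val j))%:C%C.

Definition terminating_matrix (R : realType) (S : finType)
    (A : S -> S -> R) : Prop :=
  forall z : R[i], eigenvalue (complex_matrix A) z -> `|z| < 1.

(* The state of a terminating chain on S is an element of [option S], where
   [None] means that the chain has terminated. *)

Definition init (R : realType) (S : finType) (a : S -> R) (o : option S) : R :=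
  if o is Some x then a x else 0.

Definition trans (R : realType) (S : finType) (A : S -> S -> R)
    (o o' : option S) : R :=
  match o, o' with
  | Some x, Some y => A x y
  | Some x, None => 1 - \sum_y A x y
  | None, Some _ => 0
  | None, None => 1
  end.

Definition follows (T : Type) (V : Type) (M : nat -> T -> V)
    (x : nat -> V) (n : nat) : set T :=
  [set w | forall i, (i <= n)%N -> M i w = x i].

Definition terminating_chain (d : measure_display) (T : measurableType d)
    (R : realType) (Pr : probability T R) (S : finType)
    (a : S -> R) (A : S -> S -> R) (M : nat -> T -> option S) : Prop :=
  [/\ forall n o, measurable [set w | M n w = o],
      forall o, Pr [set w | M 0%N w = o] = (init a o)%:E &
      forall n (x : nat -> option S),
        (Pr (follows M x n.+1) =
         Pr (follows M x n) * (trans A (x n) (x n.+1))%:E)%E].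

(* inf {n >= 1 : M(n) satisfies B}, with inf of the empty set equal to +oo *)
Definition first_time (R : realType) (T : Type) (V : Type)
    (M : nat -> T -> V) (B : pred V) (w : T) : \bar R :=
  ereal_inf [set (n%:R : R)%:E | n in [set n | (1 <= n)%N && B (M n w)]].

Definition termination_time (R : realType) (T : Type) (S : finType)
    (M : nat -> T -> option S) : T -> \bar R :=
  first_time R M (fun o => o == None).

(* The law of inf {n >= 1 : M(n) has terminated} is compared with mu on
   measurable sets. *)
Definition is_DPH (R : realType) (mu : set (\bar R) -> \bar R) : Prop :=
  exists (S : finType) (a : S -> R) (A : S -> S -> R),
    [/\ probability_vector a, subprobability_matrix A &
     exists (d : measure_display) (T : measurableType d)
            (Pr : probability T R) (M : nat -> T -> option S),
       [/\ terminating_chain Pr a A M,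
           {ae Pr, forall w, (termination_time R M w < +oo)%E} &
           forall B : set (\bar R), measurable B ->
             mu B = pushforward Pr (termination_time R M) B]].

Definition CDPH_parameters (R : realType) (E S : finType)
    (alpha : E -> R) (P : E -> E -> R) (U : E -> S -> R)
    (Q1 Q2 : S -> S -> R) : Prop :=
  [/\ (0 < #|E|)%N /\ (0 < #|S|)%N,
      probability_vector alpha,
      [/\ subprobability_matrix P,
          subprobability_matrix Q1 & subprobability_matrix Q2],
      [/\ forall e s, 0 <= U e s &
          forall e, \sum_e' P e e' + \sum_s U e s = 1] &
      [/\ terminating_matrix P,
          terminating_matrix Q1 & terminating_matrix Q2]].

(* The row vector (alpha, 0) on the disjoint union of E and S. *)
Definition alpha0 (R : realType) (E S : finType) (alpha : E -> R)
    (v : E + S) : R :=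
  if v is inl e then alpha e else 0.

(* The block matrix with rows (P, U) and (0, Q1). *)
Definition blockPUQ (R : realType) (E S : finType)
    (P : E -> E -> R) (U : E -> S -> R) (Q1 : S -> S -> R)
    (v v' : E + S) : R :=
  match v, v' with
  | inl e, inl e' => P e e'
  | inl e, inr s => U e s
  | inr _, inl _ => 0
  | inr s, inr s' => Q1 s s'
  end.

Definition in_E (E S : finType) (o : option (E + S)) : bool :=
  if o is Some (inl _) then true else false.

Definition split_time (R : realType) (T : Type) (E S : finType)
    (M1 : nat -> T -> option (E + S)) : T -> \bar R :=
  first_time R M1 (fun o => ~~ in_E o).

(* The deterministic trajectory x leaves E for the first time >= 1 at time n,
   and enters S at s. *)
Definition splits_at (E S : finType) (x : nat -> option (E + S))
    (n : nat) (s : S) : Prop :=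
  [/\ (1 <= n)%N, forall i, (1 <= i < n)%N -> in_E (x i) & x n = Some (inr s)].

(* In the last clause x fixes both the past up to the splitting time n and the
   later evolution of M1 up to an arbitrary time m: given these, (M2 (n + j))_j
   has the law of the Q2-chain started from s, a law which does not involve
   the later evolution of M1.  The case of M1 terminating directly from E has
   probability zero, since the rows of (P U) sum to one. *)
Definition CDPH_construction (d : measure_display) (T : measurableType d)
    (R : realType) (Pr : probability T R) (E S : finType)
    (alpha : E -> R) (P : E -> E -> R) (U : E -> S -> R)
    (Q1 Q2 : S -> S -> R) (M1 M2 : nat -> T -> option (E + S)) : Prop :=
  [/\ terminating_chain Pr (alpha0 alpha) (blockPUQ P U Q1) M1,
      forall n o, measurable [set w | M2 n w = o],
      forall n w, ((n%:R : R)%:E <= split_time R M1 w)%E -> M2 n w = M1 n w &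
      forall (n m l : nat) (x : nat -> option (E + S)) (s : S)
             (y : nat -> option S),
        splits_at x n s -> (n <= m)%N -> y 0%N = Some s ->
        (Pr (follows M1 x m `&`
             [set w | forall j, (j <= l)%N ->
                        M2 (n + j)%N w = omap inr (y j)]) =
         Pr (follows M1 x m) *
           (\prod_(j < l) trans Q2 (y j) (y j.+1))%:E)%E].

Definition is_CDPH (R : realType) (E S : finType)
    (alpha : E -> R) (P : E -> E -> R) (U : E -> S -> R)
    (Q1 Q2 : S -> S -> R) (mu : set (\bar R * \bar R) -> \bar R) : Prop :=
  exists (d : measure_display) (T : measurableType d) (Pr : probability T R)
         (M1 M2 : nat -> T -> option (E + S)),
    CDPH_construction Pr alpha P U Q1 Q2 M1 M2 /\
    forall B : set (\bar R * \bar R), measurable B ->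
      mu B = pushforward Pr
        (fun w => (termination_time R M1 w, termination_time R M2 w)) B.

(* Main.v *)
Require Import Defs.
From HB Require Import structures.
From mathcomp Require Import all_boot all_order all_algebra.
From mathcomp Require Import all_classical all_reals all_analysis.
From mathcomp Require Import measurable_realfun.
From mathcomp Require Import complex zify.

(** Let n be the splitting time, so that tau1 = n + r1 and tau2 = n + r2, where
    r1 and r2 are the residual lifetimes of the two chains after the split.
    Then tau1 + tau2 = 2 n + r1 + r2 is the lifetime of a single chain: it first
    goes through the common states in E at half speed (two time units per step),
    then it runs M1 from the state s of the split while remembering s, and when
    M1 terminates it runs M2 from s. Given s, the evolution of M2 after the split
    is independent of that of M1, so running them one after the other instead of
    simultaneously does not change the law of r1 + r2. The entries of this chain
    are gathered in [sum_matrix].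

    The chain is built pathwise ([sum_chain]), on the probability space of M1
    and M2, by reading their paths in that order. Its Markov property is proved by
    comparison of trajectories: for a trajectory of nonzero weight
    (the initial probability times the product of the transition probabilities)
    there is an event on (M1, M2) which forces it and whose probability is this
    weight ([sum_chain_event]). As both the weights and the probabilities of the
    trajectories of a given length sum to one, all these lower bounds are
    equalities ([terminating_chain_of_weight_le]). The forcing events thus fill
    the events that trajectories are followed up to null sets; on the forcing
    event of a terminated trajectory the lifetimes of M1 and M2 are explicit and
    add up to its length ([phase_termination]). There are countably many
    terminated trajectories, and they carry the whole mass since the chain
    terminates almost surely; so its lifetime is almost surely tau1 + tau2.

    Almost sure termination comes from the spectral hypothesis: the survival
    probabilities [A ^ k 1] decrease to a vector fixed by [A], which has to be
    zero when 1 is not an eigenvalue ([survival_cvg0], [ae_termination]), and the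
    property of having no nonzero fixed vector passes from P, Q1 and Q2 to the
    block triangular matrix of the combined chain. *)

Set Implicit Arguments.
Unset Strict Implicit.
Unset Printing Implicit Defensive.

Import Order.TTheory GRing.Theory Num.Theory.
Import numFieldNormedType.Exports.

Local Open Scope classical_set_scope.
Local Open Scope ring_scope.

(** * Spectral condition and survival probabilities *)

(** For a substochastic matrix this already forces almost sure termination,
    and it is easier to check than a bound on all eigenvalues for the block
    triangular matrix of the chain for the sum. *)
Definition no_fixed_vector (R : realType) (S : finType) (A : S -> S -> R) :=
  forall v : S -> R, (forall x, v x = \sum_y A x y * v y) -> forall x, v x = 0.

(** Eigenvalues are defined through row vectors whereas [v] is a column vector:
    if 1 is no eigenvalue, [A - 1] is invertible, hence has trivial kernel on
    both sides. *)
Lemma terminating_no_fixed_vector (R : realType) (S : finType) (A : S -> S -> R) :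
  terminating_matrix A -> no_fixed_vector A.
Proof.
move=> tA v Av.
have nev : ~~ eigenvalue (complex_matrix A) 1.
  by apply/negP => /tA; rewrite normr1 ltxx.
have uB : complex_matrix A - 1%:M \in unitmx.
  by rewrite -row_free_unit -kermx_eq0 -[_ == _]negbK.
pose c : 'cV[R[i]]_#|S| := \col_i (v (enum_val i))%:C%C.
have Bc : (complex_matrix A - 1%:M) *m c = 0.
  apply/colP => i; rewrite mulmxBl mul1mx !mxE; apply/eqP; rewrite subr_eq0.
  apply/eqP; rewrite [in RHS](Av (enum_val i)) rmorph_sum /=.
  rewrite (reindex (enum_val (A := S))) /=; last first.
    by apply: onW_bij; apply: enum_val_bij.
  by apply: eq_bigr => j _; rewrite !mxE rmorphM.
have c0 : c = 0 by rewrite -(mulKmx uB c) Bc mulmx0.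
move=> x; have := congr1 (fun m : 'cV[R[i]]_#|S| => m (enum_rank x) 0) c0.
by rewrite !mxE enum_rankK => -[].
Qed.

(** The entries of the vector [A ^ k 1], that is, the probabilities of not
    terminating during the first [k] steps. *)
Fixpoint survival (R : realType) (S : finType) (A : S -> S -> R) (k : nat) (x : S) : R :=
  if k is k'.+1 then \sum_y A x y * survival A k' y else 1.

Section Survival.
Variables (R : realType) (S : finType) (A : S -> S -> R).
Hypothesis sA : subprobability_matrix A.

Lemma survival_ge0 k x : 0 <= survival A k x.
Proof.
elim: k x => [|k IH] x /=; first exact: ler01.
by apply: sumr_ge0 => y _; rewrite mulr_ge0 //; case: sA.
Qed.

Lemma survival_noninc k x : survival A k.+1 x <= survival A k x.
Proof.
elim: k x => [|k IH] x /=.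
  by under eq_bigr do rewrite mulr1; case: sA.
by apply: ler_sum => y _; apply: ler_wpM2l (IH y); case: sA.
Qed.

(** The survival probabilities decrease, so they converge; the limit [v]
    satisfies [v = A v]. *)
Lemma survival_cvg0 x :
  no_fixed_vector A -> survival A k x @[k --> \oo] --> (0 : R).
Proof.
move=> nA.
have cv y : cvgn (fun k => survival A k y).
  apply: nonincreasing_is_cvgn.
    apply/nonincreasing_seqP => k; exact: survival_noninc.
  by exists 0 => _ [k _ <-]; exact: survival_ge0.
pose v y := limn (fun k => survival A k y).
suff -> : 0 = v x by exact: cv.
apply/esym/nA => y; apply/cvg_lim => //.
rewrite -cvg_shiftS /=; apply: (@cvg_big _ _ +%R) => //.
  exact: add_continuous.
by move=> z _; apply: cvgMl_tmp; exact: cv.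
Qed.

End Survival.

(** * Trajectories of a discrete process *)

Section Process.
Context (d : measure_display) (T : measurableType d) (R : realType).
Variable (Pr : probability T R).

Lemma fine_prob_ge0 A : 0 <= fine (Pr A).
Proof. by rewrite fine_ge0. Qed.

Lemma fine_probK A : measurable A -> (fine (Pr A))%:E = Pr A.
Proof. by move=> mA; rewrite fineK// fin_num_measure. Qed.

Lemma prob_partition (V : finType) (X : T -> V) (A : set T) :
  (forall v, measurable [set w | X w = v]) -> measurable A ->
  fine (Pr A) = \sum_v fine (Pr (A `&` [set w | X w = v])).
Proof.
move=> mX mA; apply/EFin_inj; rewrite fine_probK// -sumEFin.
rewrite (eq_bigr (fun v => Pr (A `&` [set w | X w = v]))); last first.
  by move=> v _; rewrite fine_probK//; exact: measurableI.
have {1}-> : A = \bigcup_(v in [set` index_enum V]) (A `&` [set w | X w = v]).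
  apply/seteqP; split => [w Aw|w [v _ []]//].
  by exists (X w) => //=; exact: mem_index_enum.
rewrite fsbig_seq ?index_enum_uniq//.
apply: measure_fin_bigcup => [|u v _ _ [w [[_ <-] [_ <-]]] //|v _].
  exact: finite_seq.
exact: measurableI.
Qed.

Lemma measurable_follows (V : Type) (M : nat -> T -> V) x n :
  (forall i v, measurable [set w | M i w = v]) -> measurable (follows M x n).
Proof.
move=> mM.
have -> : follows M x n = \bigcap_(i in [set i | (i <= n)%N]) [set w | M i w = x i].
  by apply/seteqP; split.
by apply: bigcap_measurableType => i _.
Qed.

End Process.

Definition update (V : Type) (x : nat -> V) (n : nat) (v : V) : nat -> V :=
  fun i => if i == n then v else x i.

Lemma follows_ext (T V : Type) (M : nat -> T -> V) (x x' : nat -> V) n :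
  (forall i, (i <= n)%N -> x i = x' i) -> follows M x n = follows M x' n.
Proof.
by move=> xx'; apply/seteqP; split => w wx i lin; rewrite wx ?xx'.
Qed.

Lemma followsS (T V : Type) (M : nat -> T -> V) (x : nat -> V) n :
  follows M x n.+1 = follows M x n `&` [set w | M n.+1 w = x n.+1].
Proof.
apply/seteqP; split => [w wx|w [wx wn] i].
  by split=> [i lin|]; apply: wx => //; exact: leqW.
by rewrite leq_eqVlt => /predU1P[->//|]; exact: wx.
Qed.

Lemma follows_update (T V : Type) (M : nat -> T -> V) (x : nat -> V) n v :
  follows M (update x n.+1 v) n.+1 = follows M x n `&` [set w | M n.+1 w = v].
Proof.
rewrite followsS /update eqxx; congr (_ `&` _).
by apply: follows_ext => i lin; rewrite ltn_eqF.
Qed.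

Lemma follows0 (T V : Type) (M : nat -> T -> V) (x : nat -> V) :
  follows M x 0 = [set w | M 0%N w = x 0%N].
Proof.
by apply/seteqP; split => [w /(_ _ (leqnn 0))//|w wx i]; rewrite leqn0 => /eqP ->.
Qed.

(** * Weights of trajectories *)

Definition weight (R : realType) (S : finType) (a : S -> R) (A : S -> S -> R)
    (x : nat -> option S) (n : nat) : R :=
  init a (x 0%N) * \prod_(i < n) trans A (x i) (x i.+1).

Lemma weightS (R : realType) (S : finType) (a : S -> R) A x n :
  weight a A x n.+1 = weight a A x n * trans A (x n) (x n.+1).
Proof. by rewrite /weight big_ord_recr mulrA. Qed.

Lemma weight_update (R : realType) (S : finType) (a : S -> R) A x n o :
  weight a A (update x n.+1 o) n.+1 = weight a A x n * trans A (x n) o.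
Proof.
rewrite weightS /update eqxx (ltn_eqF (ltnSn n)); congr (_ * _).
rewrite /weight/=; congr (_ * _); apply: eq_bigr => i _.
by rewrite eqSS (ltn_eqF (ltn_ord i)) (ltn_eqF (leqW (ltn_ord i))).
Qed.

Lemma sum_option (R : realType) (S : finType) (F : option S -> R) :
  \sum_o F o = F None + \sum_s F (Some s).
Proof.
rewrite (bigD1 None)//=; congr (_ + _).
rewrite (reindex_omap Some id)/=; last by case.
by apply: eq_bigl => s; rewrite eqxx.
Qed.

Lemma sum_trans (R : realType) (S : finType) (A : S -> S -> R) o :
  \sum_o' trans A o o' = 1.
Proof.
rewrite sum_option; case: o => [x|] /=; first by rewrite subrK.
by rewrite big1// addr0.
Qed.

Lemma sum_init (R : realType) (S : finType) (a : S -> R) :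
  \sum_o init a o = \sum_s a s.
Proof. by rewrite sum_option /= add0r. Qed.

(** Turns lower bounds into equalities when the total masses agree. *)
Lemma eq_of_le_sum (R : realType) (V : finType) (f g : V -> R) :
  (forall v, f v <= g v) -> \sum_v f v = \sum_v g v -> f =1 g.
Proof.
move=> fg sfg v; apply/esym/eqP; rewrite -subr_eq0.
have := @psumr_eq0P R V xpredT (fun v => g v - f v).
move=> /(_ _ _ v isT) ->//.
- by move=> u _; rewrite subr_ge0.
- by rewrite sumrB sfg subrr.
Qed.

Section Chain.
Context (d : measure_display) (T : measurableType d) (R : realType).
Variables (Pr : probability T R) (S : finType) (a : S -> R) (A : S -> S -> R).
Variable (M : nat -> T -> option S).
Hypothesis mM : forall n o, measurable [set w | M n w = o].

Lemma prob_follows x n :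
  terminating_chain Pr a A M -> Pr (follows M x n) = (weight a A x n)%:E.
Proof.
move=> [_ iM tM]; elim: n => [|n IH].
  by rewrite follows0 iM /weight big_ord0 mulr1.
by rewrite tM IH weightS EFinM.
Qed.

(** The probabilities of the trajectories of a given length sum to one, and so
    do their weights; hence a lower bound for every trajectory is an equality.
    Trajectories of weight zero therefore need no inspection, and for the others
    it is enough to exhibit a subevent of the right probability. *)
Lemma terminating_chain_of_weight_le :
  probability_vector a -> subprobability_matrix A ->
  (forall x n, weight a A x n != 0 ->
    ((weight a A x n)%:E <= Pr (follows M x n))%E) ->
  terminating_chain Pr a A M.
Proof.
move=> pa sA wle.
have mF x n : measurable (follows M x n) by exact: measurable_follows.
have {}wle x n : weight a A x n <= fine (Pr (follows M x n)).
  have [->|w0] := eqVneq (weight a A x n) 0; first exact: fine_prob_ge0.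
  by rewrite -lee_fin fine_probK// wle.
suff main n x : fine (Pr (follows M x n)) = weight a A x n.
  split => //.
    move=> o; rewrite -(follows0 M (fun=> o)) -fine_probK// main.
    by rewrite /weight big_ord0 mulr1.
  have mainE n x : Pr (follows M x n) = (weight a A x n)%:E.
    by rewrite -main fine_probK.
  by move=> n x; rewrite !mainE weightS EFinM.
elim: n x => [|n IH] x.
  rewrite (@follows_ext _ _ _ x (fun=> x 0%N)); last by case.
  have -> : weight a A x 0 = weight a A (fun=> x 0%N) 0 by rewrite /weight !big_ord0.
  apply/esym; move: (x 0%N); apply: eq_of_le_sum => [q|]; first exact: wle.
  under eq_bigr do rewrite /weight big_ord0 mulr1.
  rewrite sum_init; case: pa => _ ->.
  under eq_bigr do rewrite follows0 -[X in Pr X]setTI.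
  by rewrite -prob_partition// probability_setT.
have ux : update x n.+1 (x n.+1) = x.
  by apply/funext => i; rewrite /update; case: eqVneq => [->|].
rewrite -ux; apply/esym; move: (x n.+1); apply: eq_of_le_sum => [q|]; first exact: wle.
under eq_bigr do rewrite weight_update.
rewrite -mulr_sumr sum_trans mulr1 -IH (prob_partition Pr (mM n.+1))//.
by apply: eq_bigr => o _; rewrite follows_update.
Qed.

End Chain.

(** * First times *)

Section FirstTime.
Context (R : realType) (T V : Type) (M : nat -> T -> V) (B : pred V).

Lemma first_time_eq w n : (1 <= n)%N -> B (M n w) ->
  (forall i, (1 <= i < n)%N -> ~~ B (M i w)) ->
  first_time R M B w = (n%:R : R)%:E.
Proof.
move=> n1 Bn nB; apply/eqP; rewrite eq_le; apply/andP; split.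
  by apply: ereal_inf_lbound; exists n => //=; rewrite n1.
apply: le_ereal_inf_tmp => _ [m /andP[m1 Bm] <-].
by rewrite lee_fin ler_nat leqNgt; apply: contraL Bm => mn; rewrite nB ?m1.
Qed.

Lemma first_time_ge w n : (forall i, (1 <= i < n)%N -> ~~ B (M i w)) ->
  ((n%:R : R)%:E <= first_time R M B w)%E.
Proof.
move=> nB; apply: le_ereal_inf_tmp => _ [m /andP[m1 Bm] <-].
by rewrite lee_fin ler_nat leqNgt; apply: contraL Bm => mn; rewrite nB ?m1.
Qed.

Lemma first_time_cases w :
  (exists n, [/\ (1 <= n)%N, B (M n w), forall i, (1 <= i < n)%N -> ~~ B (M i w) &
    first_time R M B w = (n%:R : R)%:E]) \/
  ((forall n, (1 <= n)%N -> ~~ B (M n w)) /\ first_time R M B w = +oo%E :> \bar R).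
Proof.
have [ex|nex] := pselect (exists n, (1 <= n)%N && B (M n w)).
  left; have [n /andP[n1 Bn] nmin] := ex_minnP ex; exists n.
  have nB i : (1 <= i < n)%N -> ~~ B (M i w).
    move=> /andP[i1 ilt]; apply: contraL ilt => Bi.
    by rewrite -leqNgt nmin// i1.
  by split => //; exact: first_time_eq.
have nB n : (1 <= n)%N -> ~~ B (M n w).
  by move=> n1; apply/negP => Bn; apply: nex; exists n; rewrite n1.
right; split => //; apply/ereal_inf_pinfty => _ [m /andP[m1 Bm] <-].
by rewrite (negbTE (nB _ m1)) in Bm.
Qed.

End FirstTime.

Section FirstTimeMeasurable.
Context (R : realType) (d : measure_display) (T : measurableType d).
Context (S : finType) (M : nat -> T -> option S).
Hypothesis mM : forall n o, measurable [set w | M n w = o].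

Lemma measurable_alive n : measurable [set w | M n w != None].
Proof.
rewrite (_ : [set _ | _] = ~` [set w | M n w = None]); first exact: measurableC.
by apply/seteqP; split => w /= /eqP.
Qed.

(** A termination time takes the values 1, 2, ... and [+oo], each of them on a
    countable intersection of events on single coordinates. *)
Lemma measurable_termination_time :
  measurable_fun setT (termination_time R M).
Proof.
pose at_ n := [set w | M n w = None] `&`
  \bigcap_(i in [set i | (1 <= i < n)%N]) [set w | M i w != None].
pose never := \bigcap_(i in [set i | (1 <= i)%N]) [set w | M i w != None].
have mat n : measurable (at_ n).
  apply: measurableI => //; apply: bigcap_measurableType => i _.
  exact: measurable_alive.
have mnever : measurable never.
  by apply: bigcap_measurableType => i _; exact: measurable_alive.
move=> _ B mB; rewrite setTI.
have -> : termination_time R M @^-1` B =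
    (\bigcup_(n in [set n | (1 <= n)%N /\ B (n%:R)%:E]) at_ n) `|`
    (if pselect (B +oo%E) then never else set0).
  apply/seteqP; split => w /=.
    rewrite /termination_time.
    have [[n [n1 /eqP Mn Mi ->]]|[nM ->]] :=
        first_time_cases R M (fun o => o == None) w; move=> Bn.
      by left; exists n => //; split.
    by right; case: pselect.
  move=> [[n [n1 Bn] [/eqP Mn Mi]]|].
    by rewrite /termination_time (@first_time_eq _ _ _ _ _ _ n).
  case: pselect => // Boo Mi.
  rewrite /termination_time.
  have [[n [n1 Mn]]|[_ ->//]] := first_time_cases R M (fun o => o == None) w.
  by move: (Mi n n1) => /=; rewrite Mn.
apply: measurableU; first by apply: bigcup_measurable => n _.
by case: (is_left _).
Qed.

End FirstTimeMeasurable.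

(** * Almost sure termination *)

Section Termination.
Context (d : measure_display) (T : measurableType d) (R : realType).
Variables (Pr : probability T R) (S : finType) (a : S -> R) (A : S -> S -> R).
Variable (M : nat -> T -> option S).
Hypothesis (sA : subprobability_matrix A) (tM : terminating_chain Pr a A M).

Let alive n k := [set w | forall i, (n < i <= n + k)%N -> M i w != None].

Let mM n o : measurable [set w | M n w = o]. Proof. by case: tM. Qed.

Let malive n k : measurable (alive n k).
Proof.
rewrite (_ : alive n k =
    \bigcap_(i in [set i | (n < i <= n + k)%N]) [set w | M i w != None])//.
by apply: bigcap_measurableType => i _; exact: measurable_alive.
Qed.

Let survivalo k (o : option S) : R :=
  if o is Some s then survival A k s else (k == 0%N)%:R.

(** The Markov property over [k] steps for the event of staying alive, by
    conditioning on the next state. *)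
Lemma prob_follows_alive x n k :
  fine (Pr (follows M x n `&` alive n k)) = weight a A x n * survivalo k (x n).
Proof.
elim: k x n => [|k IH] x n.
  rewrite (_ : alive n 0 = setT) ?setIT.
    rewrite (prob_follows x n tM)/= /survivalo.
    by case: (x n) => [s|]; rewrite /= mulr1.
  apply/seteqP; split => // w _ i.
  by rewrite addn0 => /andP[/leq_trans/[apply]]; rewrite ltnn.
have mF y m : measurable (follows M y m) by exact: measurable_follows.
rewrite (prob_partition Pr (mM n.+1)); last exact: measurableI.
rewrite sum_option.
rewrite (_ : _ `&` _ `&` _ = set0); last first.
  apply/seteqP; split => // w [[_ /(_ n.+1)]] /[swap] /= ->.
  by rewrite ltnSn addnS ltnS leq_addr => /(_ isT).
rewrite measure0 add0r.
under eq_bigr => s _.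
  rewrite (_ : _ `&` _ `&` _ =
      follows M (update x n.+1 (Some s)) n.+1 `&` alive n.+1 k); last first.
    rewrite follows_update; apply/seteqP; split => w [].
      move=> [wx al] Ms; split => // i /andP[ni ink]; apply: al.
      by rewrite (ltnW ni) addnS -addSn.
    move=> [wx Ms] al; split => //; split => // i /andP[ni ink].
    have [->|ine] := eqVneq i n.+1; first by rewrite Ms.
    by apply: al; rewrite ltn_neqAle eq_sym ine ni addSn -addnS.
  rewrite IH weight_update /update eqxx /=; over.
case: (x n) => [t|] /=; last first.
  by rewrite mulr0n mulr0 big1// => s _; rewrite mul0r.
by rewrite mulr_sumr; apply: eq_bigr => s _; rewrite mulrA.
Qed.

(** The event of never terminating is contained in the events of surviving
    [k] steps, whose probabilities tend to zero. *)
Lemma ae_termination : no_fixed_vector A ->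
  {ae Pr, forall w, (termination_time R M w < +oo)%E}.
Proof.
move=> nA.
pose never := \bigcap_(i in [set i | (1 <= i)%N]) [set w | M i w != None].
have mnever : measurable never.
  by apply: bigcap_measurableType => i _; exact: measurable_alive.
have Palive k : fine (Pr (alive 0 k)) = \sum_s a s * survival A k s.
  rewrite (prob_partition Pr (mM 0)) // sum_option.
  under eq_bigr => s _ do
    rewrite setIC -(follows0 M (fun=> Some s)) prob_follows_alive
      /weight big_ord0 mulr1 /=.
  by rewrite setIC -(follows0 M (fun=> None)) prob_follows_alive
    /weight big_ord0 /= !mul0r add0r.
have cv : fine (Pr (alive 0 k)) @[k --> \oo] --> (0 : R).
  rewrite (_ : 0 = \sum_s a s * 0); last by rewrite big1// => s _; rewrite mulr0.
  under eq_cvg do rewrite Palive.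
  apply: (@cvg_big _ _ +%R) => //; first exact: add_continuous.
  by move=> s _; apply: cvgMl_tmp; exact: survival_cvg0.
exists never; split => //; last first.
  move=> w /= h i /= i1; apply/negP => /eqP Mi; apply: h.
  rewrite /termination_time.
  have [[n [_ _ _ ->]]|[+ _]] := first_time_cases R M (fun o => o == None) w.
    exact: ltry.
  by move=> /(_ i i1); rewrite Mi.
rewrite -fine_probK//; congr _%:E; apply/eqP; rewrite eq_le fine_prob_ge0 andbT.
rewrite -(cvg_lim (@Rhausdorff R) cv); apply: limr_ge; first exact: cvgP cv.
apply: nearW => k.
rewrite fine_le ?fin_num_measure// le_measure ?inE// => w wn i /andP[i1 _].
exact: wn.
Qed.

End Termination.

(** * Measurability of maps with countably many values *)

Section DiscreteMeasurability.
Context (d : measure_display) (T : measurableType d).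

Definition discretely_measurable (V : Type) (X : T -> V) :=
  forall D : set V, measurable (X @^-1` D).

Lemma discretely_measurable_cst (V : Type) (v : V) :
  discretely_measurable (fun=> v).
Proof. by move=> D; rewrite preimage_cst; case: ifP. Qed.

Lemma discretely_measurable_comp (V W : Type) (f : V -> W) (X : T -> V) :
  discretely_measurable X -> discretely_measurable (fun w => f (X w)).
Proof. by move=> mX D; exact: (mX (f @^-1` D)). Qed.

(** Which coordinate of a process is observed may depend on the outcome of
    countably valued observations made before. *)
Lemma discretely_measurable_bind (V : countType) (W : Type) (X : T -> V)
    (F : V -> T -> W) :
  discretely_measurable X -> (forall v, discretely_measurable (F v)) ->
  discretely_measurable (fun w => F (X w) w).
Proof.
move=> mX mF D.
have -> : (fun w => F (X w) w) @^-1` D =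
    \bigcup_v (X @^-1` [set v] `&` F v @^-1` D).
  by apply/seteqP; split => [w Dw|w [v _ [<-]]//]; exists (X w).
apply: countable_bigcupT_measurable => [|v]; first exact: countableP.
by apply: measurableI; [exact: mX|exact: mF].
Qed.

Lemma discretely_measurable_fin (V : finType) (X : T -> V) :
  (forall v, measurable [set w | X w = v]) -> discretely_measurable X.
Proof.
move=> mX D.
have -> : X @^-1` D = \bigcup_(v in D) [set w | X w = v].
  by apply/seteqP; split => [w Dw|w [v Dv /= ->]//]; exists (X w).
by apply: fin_bigcup_measurable => // ; exact: finite_finset.
Qed.

End DiscreteMeasurability.

(** * The transition matrix of the chain for the sum *)

Section SumChain.
Variables (E S : finType).

(** A state [(e, b)] is the common state [e] in E, each step of which is
    counted twice, the bit [b] telling the two copies apart. A state [(s, t)]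
    means that the split took place at [s] and that M1 is now in [t]; the entry
    state [s] is kept because M2 is run afterwards, from [s]. The last summand
    holds the current state of M2, once M1 has terminated. *)
Definition sum_state : finType := ((E * bool) + (S * S) + S)%type.

Definition sum_vector (R : realType) (alpha : E -> R) (x : sum_state) : R :=
  if x is inl (inl (e, false)) then alpha e else 0.

Definition sum_matrix (R : realType) (P : E -> E -> R) (U : E -> S -> R)
    (Q1 Q2 : S -> S -> R) (x y : sum_state) : R :=
  match x, y with
  | inl (inl (e, false)), inl (inl (e', true)) => (e == e')%:R
  | inl (inl (e, true)), inl (inl (e', false)) => P e e'
  | inl (inl (e, true)), inl (inr (s, t)) => (s == t)%:R * U e s
  | inl (inr (s, t)), inl (inr (s', t')) => (s == s')%:R * Q1 t t'
  | inl (inr (s, t)), inr s' => (s == s')%:R * (1 - \sum_t' Q1 t t')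
  | inr t, inr t' => Q2 t t'
  | _, _ => 0
  end.

Section Matrix.
Variables (R : realType) (alpha : E -> R).
Variables (P : E -> E -> R) (U : E -> S -> R) (Q1 Q2 : S -> S -> R).
Local Notation A := (sum_matrix P U Q1 Q2).

Lemma sum_sum_state (F : sum_state -> R) : \sum_x F x =
  \sum_e F (inl (inl (e, false))) + \sum_e F (inl (inl (e, true))) +
  \sum_s \sum_t F (inl (inr (s, t))) + \sum_t F (inr t).
Proof.
rewrite big_sumType/= big_sumType/=; congr (_ + _ + _).
  transitivity (\sum_e \sum_b F (inl (inl (e, b)))).
    by rewrite pair_bigA/=; apply: eq_bigr => -[].
  by rewrite exchange_big/= big_bool addrC.
by rewrite pair_bigA/=; apply: eq_bigr => -[].
Qed.

Lemma sum_delta (I : finType) (i : I) (G : I -> R) :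
  \sum_j (i == j)%:R * G j = G i.
Proof.
rewrite (bigD1 i)//= eqxx mul1r big1 ?addr0// => j /negbTE.
by rewrite eq_sym => ->; rewrite mul0r.
Qed.

(** The action on column vectors gives the row sums (for [f = 1]) as well as
    the equation of fixed vectors. *)
Lemma sum_matrix_row (f : sum_state -> R) x : \sum_y A x y * f y =
  match x with
  | inl (inl (e, false)) => f (inl (inl (e, true)))
  | inl (inl (e, true)) =>
      \sum_e' P e e' * f (inl (inl (e', false))) + \sum_s U e s * f (inl (inr (s, s)))
  | inl (inr (s, t)) =>
      \sum_t' Q1 t t' * f (inl (inr (s, t'))) + (1 - \sum_t' Q1 t t') * f (inr s)
  | inr t => \sum_t' Q2 t t' * f (inr t')
  end.
Proof.
have z (I : finType) (G : I -> R) : \sum_i 0 * G i = 0.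
  by rewrite big1// => i _; rewrite mul0r.
have zz (I J : finType) (G : I -> J -> R) : \sum_i \sum_j 0 * G i j = 0.
  by rewrite big1// => i _; rewrite z.
rewrite sum_sum_state; case: x => [[[e []]|[s t]]|t] /=.
- rewrite !z !addr0; congr (_ + _); apply: eq_bigr => s _.
  under eq_bigr do rewrite -mulrA.
  by rewrite sum_delta.
- by rewrite !z zz !addr0 add0r sum_delta.
- rewrite !z !add0r; congr (_ + _).
    under eq_bigr => s' _ do under eq_bigr do rewrite -mulrA.
    under eq_bigr do rewrite -mulr_sumr.
    by rewrite sum_delta.
  under eq_bigr do rewrite -mulrA.
  by rewrite sum_delta.
- by rewrite !z zz !add0r.
Qed.

Hypothesis hpar : CDPH_parameters alpha P U Q1 Q2.

Lemma probability_sum_vector : probability_vector (sum_vector alpha).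
Proof.
case: hpar => _ [a0 a1] _ _ _; split; first by move=> [[[e []]|[]]|] /=.
by rewrite sum_sum_state /= a1 !big1 ?addr0// => s _.
Qed.

Lemma sum_matrix_total x :
  \sum_y A x y = if x is inr t then \sum_t' Q2 t t' else 1.
Proof.
case: hpar => _ _ _ [_ PU] _.
have one (I : finType) (G : I -> R) : \sum_i G i * 1 = \sum_i G i.
  by apply: eq_bigr => i _; rewrite mulr1.
rewrite -one sum_matrix_row; case: x => [[[e []]|[s t]]|t]; rewrite ?one//.
by rewrite mulr1 addrC subrK.
Qed.

Lemma subprobability_sum_matrix : subprobability_matrix A.
Proof.
case: hpar => _ _ [[P0 _] [Q10 Q11] [Q20 Q21]] [U0 PU] _; split.
  move=> [[[e []]|[s t]]|t] [[[e' []]|[s' t']]|t'] //=;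
    by rewrite ?mulr_ge0 ?ler0n ?subr_ge0.
by move=> x; rewrite sum_matrix_total; case: x => [x|t].
Qed.

Lemma sum_matrix_no_exit x : @trans R sum_state A (Some (inl x)) None = 0.
Proof. by rewrite /trans sum_matrix_total subrr. Qed.

(** The matrix is block triangular: a fixed vector vanishes on the states of
    M2 because of Q2, then on the states [(s, t)] because of Q1, and then on the
    copies of E because of P. *)
Lemma sum_matrix_no_fixed_vector : no_fixed_vector A.
Proof.
case: hpar => _ _ _ _ [/terminating_no_fixed_vector nP
  /terminating_no_fixed_vector nQ1 /terminating_no_fixed_vector nQ2] v Av.
have {}Av x := etrans (Av x) (sum_matrix_row v x).
have v2 t : v (inr t) = 0.
  by apply: (nQ2 (fun t => v (inr t))) => {}t; rewrite Av.
have v1 s t : v (inl (inr (s, t))) = 0.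
  apply: (nQ1 (fun t => v (inl (inr (s, t))))) => {}t.
  by rewrite Av v2 mulr0 addr0.
have vt e : v (inl (inl (e, true))) = 0.
  apply: (nP (fun e => v (inl (inl (e, true))))) => {}e; rewrite Av.
  under [X in _ + X]eq_bigr do rewrite v1 mulr0.
  by rewrite big1_eq addr0; apply: eq_bigr => e' _; rewrite Av.
by move=> [[[e []]|[s t]]|t]; rewrite ?v2 ?v1 ?vt// Av vt.
Qed.

End Matrix.

(** * The pathwise construction *)

(** Position of the reading process along the paths of M1 and M2. In the three
    phases it is: the index i reached on M1 together with the parity bit; the
    splitting time n together with the index m reached on M1; the index j
    reached on M2. *)
Definition clock : countType := ((nat * bool) + (nat * nat) + nat)%type.

Definition tick (u : nat -> option (E + S)) (c : clock) : clock :=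
  match c with
  | inl (inl (i, false)) => inl (inl (i, true))
  | inl (inl (i, true)) =>
      if in_E (u i.+1) then inl (inl (i.+1, false)) else inl (inr (i.+1, i.+1))
  | inl (inr (n, m)) => if u m.+1 == None then inr n else inl (inr (n, m.+1))
  | inr j => inr j.+1
  end.

Definition clock_at (u : nat -> option (E + S)) (k : nat) : clock :=
  iter k (tick u) (inl (inl (0%N, false))).

Definition read_state (u v : nat -> option (E + S)) (c : clock) : option sum_state :=
  match c with
  | inl (inl (i, b)) => if u i is Some (inl e) then Some (inl (inl (e, b))) else None
  | inl (inr (n, m)) =>
      if (u n, u m) is (Some (inr s), Some (inr t)) then Some (inl (inr (s, t)))
      else None
  | inr j => if v j is Some (inr t) then Some (inr t) else None
  end.

Definition sum_chain (T : Type) (M1 M2 : nat -> T -> option (E + S)) (k : nat) (w : T) :=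
  read_state (M1^~ w) (M2^~ w) (clock_at (M1^~ w) k).

Section Pathwise.
Context (d : measure_display) (T : measurableType d) (R : realType).
Variables (Pr : probability T R).
Variables (alpha : E -> R) (P : E -> E -> R) (U : E -> S -> R) (Q1 Q2 : S -> S -> R).
Variables (M1 M2 : nat -> T -> option (E + S)).
Hypothesis hpar : CDPH_parameters alpha P U Q1 Q2.
Hypothesis hM : CDPH_construction Pr alpha P U Q1 Q2 M1 M2.
Local Notation A := (sum_matrix P U Q1 Q2).
Local Notation B := (blockPUQ P U Q1).
Local Notation M := (sum_chain M1 M2).

Let mM1 n o : measurable [set w | M1 n w = o]. Proof. by case: hM => -[]. Qed.
Let mM2 n o : measurable [set w | M2 n w = o]. Proof. by case: hM. Qed.

Lemma measurable_sum_chain k o : measurable [set w | M k w = o].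
Proof.
have dM1 n := discretely_measurable_fin (mM1 n).
have dM2 n := discretely_measurable_fin (mM2 n).
suff : discretely_measurable (M k) by move=> /(_ [set o]).
rewrite /sum_chain.
apply: (@discretely_measurable_bind _ _ _ _ (fun w => clock_at (M1^~ w) k)
    (fun c w => read_state (M1^~ w) (M2^~ w) c)).
  elim: k => [|k IH]; first exact: discretely_measurable_cst.
  apply: (@discretely_measurable_bind _ _ _ _ (fun w => clock_at (M1^~ w) k)
    (fun c w => tick (M1^~ w) c)) => // -[[[i []]|[n m]]|j].
  - exact: (@discretely_measurable_comp _ _ _ _ (fun v =>
      if in_E v then inl (inl (i.+1, false)) else inl (inr (i.+1, i.+1)) : clock)).
  - exact: discretely_measurable_cst.
  - exact: (@discretely_measurable_comp _ _ _ _ (fun v =>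
      if v == None then inr n else inl (inr (n, m.+1)) : clock)).
  - exact: discretely_measurable_cst.
move=> [[[i b]|[n m]]|j].
- exact: (@discretely_measurable_comp _ _ _ _ (fun v =>
    if v is Some (inl e) then Some (inl (inl (e, b)) : sum_state) else None)).
- apply: (@discretely_measurable_bind _ _ _ _ (M1 n) (fun v w =>
    if (v, M1 m w) is (Some (inr s), Some (inr t))
    then Some (inl (inr (s, t)) : sum_state) else None)) => // v.
  exact: (@discretely_measurable_comp _ _ _ _ (fun v' =>
    if (v, v') is (Some (inr s), Some (inr t))
    then Some (inl (inr (s, t)) : sum_state) else None)).
- exact: (@discretely_measurable_comp _ _ _ _ (fun v =>
    if v is Some (inr t) then Some (inr t : sum_state) else None)).
Qed.

Let follows2 n l (y : nat -> option S) :=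
  [set w | forall j, (j <= l)%N -> M2 (n + j)%N w = omap inr (y j)].

(** An event that prescribes the paths of M1 and M2 as far as they have been
    read at time [k], according to the phase reached at this time. The path [u]
    prescribes M1 and [y] the evolution of M2 after the split, so that the
    probability of each of these events is known; moreover the clock is constant
    on them. With splitting time [n], the index [m] is reached on M1 at time
    [n + m], because the first [n] steps are counted twice; if M1 terminates
    at [m], then M2 is read from index [n] on, from that time. *)
Inductive phase (x : nat -> option sum_state) (k : nat) : set T -> Prop :=
| phase_common i (b : bool) u e of k = (i.*2 + b)%N & x k = Some (inl (inl (e, b))) &
    u i = Some (inl e) & (forall j, (j <= i)%N -> in_E (u j)) &
    (forall w, follows M1 u i w -> clock_at (M1^~ w) k = inl (inl (i, b))) :
  phase x k (follows M1 u i)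
| phase_first n m u (s t : S) of k = (n + m)%N & (n <= m)%N &
    x k = Some (inl (inr (s, t))) & splits_at u n s & u m = Some (inr t) &
    (forall j, (j <= m)%N -> u j != None) &
    (forall w, follows M1 u m w -> clock_at (M1^~ w) k = inl (inr (n, m))) :
  phase x k (follows M1 u m)
| phase_second n m l u (s : S) (y : nat -> option S) of
    k = (n + m + l)%N & (n < m)%N & splits_at u n s &
    u m = None & (forall j, (j < m)%N -> u j != None) & y 0%N = Some s &
    (forall j, (j <= l)%N -> x (n + m + j)%N = omap inr (y j)) &
    (forall w, follows M1 u m w -> clock_at (M1^~ w) k = inr (n + l)%N) :
  phase x k (follows M1 u m `&` follows2 n l y).

Lemma measurable_phase x k H : phase x k H -> measurable H.
Proof.
case=> [i b u e _ _ _ _ _|n m u s t _ _ _ _ _ _ _|n m l u s y _ _ _ _ _ _ _ _];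
  try exact: measurable_follows.
apply: measurableI; first exact: measurable_follows.
rewrite /follows2; set F := [set w | _].
rewrite (_ : F = \bigcap_(j in [set j | (j <= l)%N])
  [set w | M2 (n + j)%N w = omap inr (y j)])//.
by apply: bigcap_measurableType.
Qed.

(** If the chain terminates at time [k = n + m + l], then M1 terminates at
    [m] and M2 at [n + l]. *)
Lemma phase_termination x k H w : phase x k H -> H w -> x k = None ->
  (forall i, (1 <= i < k)%N -> x i != None) ->
  (termination_time R M1 w + termination_time R M2 w = (k%:R)%:E)%E.
Proof.
move=> ph Hw xk xi; case: ph Hw xk xi => [i b u e _ -> //|n m u s t _ _ -> //|].
move=> n m l u s y -> nm [n1 uE us] um unN y0 xy _ [Hu Hy] xk xi.
have yl : y l = None by move: xk; rewrite xy//; case: (y l).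
have l0 : (0 < l)%N by case: l yl {Hy xk xy xi} => //; rewrite y0.
rewrite /termination_time (@first_time_eq _ _ _ M1 _ _ m); first last.
- by move=> i /andP[_ im]; rewrite Hu ?unN// ltnW.
- by rewrite Hu ?um.
- exact: leq_ltn_trans nm.
rewrite (@first_time_eq _ _ _ M2 _ _ (n + l)); first last.
- move=> i /andP[i1 inl]; have [ni|iln] := leqP n i.
    have /xi : (1 <= m + i < n + m + l)%N by lia.
    rewrite -(subnKC ni) in inl *; rewrite Hy; last by lia.
    by rewrite addnA (addnC m) xy; [case: (y _)|lia].
  have [_ _ M2E _] := hM; rewrite M2E.
    by rewrite Hu ?unN//; lia.
  apply: first_time_ge => j /andP[j1 ji]; rewrite Hu; last by lia.
  by rewrite negbK uE//; lia.
- by rewrite Hy ?yl.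
- by rewrite addn_gt0 n1.
by rewrite -EFinD -natrD; congr (_%:R)%:E; lia.
Qed.

Lemma prob_follows_update u n v :
  Pr (follows M1 (update u n.+1 v) n.+1) =
  (Pr (follows M1 u n) * (trans B (u n) v)%:E)%E.
Proof.
have [[_ _ tM] _ _ _] := hM; rewrite tM; congr (_ * _)%E.
  by congr (Pr _); apply: follows_ext => i lin; rewrite /update ltn_eqF.
by rewrite /update eqxx ltn_eqF.
Qed.

(** By induction on [k]: a transition of nonzero probability extends the
    prescribed path of M1 or of M2 by one state, which multiplies the
    probability of the event by the entry of the matrix. The exception is the
    step from [(e, false)] to [(e, true)], which has probability one and
    prescribes nothing new. When M1 terminates, its path is extended by [None];
    that M2 is in [s] at the splitting time can be added to the event without
    changing its probability. *)
Lemma sum_chain_event x k : weight (sum_vector alpha) A x k != 0 ->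
  exists H, [/\ phase x k H, H `<=` follows M x k &
    Pr H = (weight (sum_vector alpha) A x k)%:E].
Proof.
elim: k => [|k IH].
  rewrite /weight big_ord0 mulr1.
  case x0: (x 0%N) => [[[[e []]|]|]|] //=; rewrite ?eqxx// => _.
  pose u : nat -> option (E + S) := fun=> Some (inl e).
  exists (follows M1 u 0); split.
  - by apply: (@phase_common _ _ _ false _ e).
  - by rewrite !follows0 x0 => w /= uw; rewrite /sum_chain /= uw.
  - by rewrite follows0; case: hM => -[_ -> _].
rewrite weightS mulf_eq0 negb_or => /andP[/IH[H [ph Hx PH]] tr].
suff [H' [ph' H'H H'x PH']] : exists H', [/\ phase x k.+1 H', H' `<=` H,
    H' `<=` [set w | M k.+1 w = x k.+1] &
    Pr H' = (Pr H * (trans A (x k) (x k.+1))%:E)%E].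
  exists H'; split => //; last by rewrite PH' PH EFinM.
  by rewrite followsS => w Hw; split; [apply/Hx/H'H|exact: H'x].
have sub u n v : follows M1 (update u n.+1 v) n.+1 `<=` follows M1 u n.
  by rewrite follows_update => w [].
have last_ u n v w : follows M1 (update u n.+1 v) n.+1 w -> M1 n.+1 w = v.
  by rewrite follows_update => -[].
have clockS u : clock_at u k.+1 = tick u (clock_at u k) by [].
have updE (V : Type) (u : nat -> V) n v j : (j <= n)%N -> update u n.+1 v j = u j.
  by move=> jn; rewrite /update ltn_eqF.
have updn (V : Type) (u : nat -> V) n v : update u n.+1 v n.+1 = v.
  by rewrite /update eqxx.
case: ph tr => [i b u e kE xk ui uE ck|n m u s t kE nm xk us ut uN ck|
    n m l u s y kE nm us um uN y0 xy ck].
- rewrite xk; case: b xk kE ck => xk kE ck; last first.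
    (* second copy of the current common state: the event is kept *)
    case xk1: (x k.+1) => [[[[e' []]|[]]|]|];
      rewrite ?(sum_matrix_no_exit hpar)//= ?eqxx//.
    have [ee|_] := eqVneq e e'; last by rewrite eqxx.
    subst e' => _; exists (follows M1 u i); split => //.
    + apply: (@phase_common _ _ i true u e) => //; first by rewrite kE addn0 addn1.
      by move=> w uw; rewrite clockS ck.
    + by move=> w uw; rewrite /= /sum_chain clockS ck//= uw// ui.
    + by rewrite mule1.
  case xk1: (x k.+1) => [[[[e' []]|[s t]]|]|];
    rewrite ?(sum_matrix_no_exit hpar)//= ?eqxx//.
    move=> _; pose u' := update u i.+1 (Some (inl e')).
    exists (follows M1 u' i.+1); split => //.
    + apply: (@phase_common _ _ i.+1 false u' e') => //; first by lia.
      * by rewrite /u' updn.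
      * move=> j; rewrite leq_eqVlt => /predU1P[->|ji]; first by rewrite /u' updn.
        by rewrite /u' updE// uE.
      * by move=> w uw; rewrite clockS (ck _ (sub _ _ _ _ uw))/= (last_ _ _ _ _ uw).
    + exact: sub.
    + move=> w uw; rewrite /= /sum_chain clockS (ck _ (sub _ _ _ _ uw))/=.
      by rewrite (last_ _ _ _ _ uw)/= (last_ _ _ _ _ uw).
    + by rewrite prob_follows_update ui.
  (* the split: the path of M1 enters S *)
  have [st|_] := eqVneq s t; last by rewrite mul0r eqxx.
  subst t => _; pose u' := update u i.+1 (Some (inr s)).
  exists (follows M1 u' i.+1); split => //.
  + apply: (@phase_first _ _ i.+1 i.+1 u' s s) => //; first by lia.
    * split => //; last by rewrite /u' updn.
      by move=> j /andP[_ ji]; rewrite /u' updE// uE.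
    * by rewrite /u' updn.
    * move=> j; rewrite leq_eqVlt => /predU1P[->|ji]; first by rewrite /u' updn.
      by rewrite /u' updE//; have := uE j ji; case: (u j).
    * by move=> w uw; rewrite clockS (ck _ (sub _ _ _ _ uw))/= (last_ _ _ _ _ uw).
  + exact: sub.
  + move=> w uw; rewrite /= /sum_chain clockS (ck _ (sub _ _ _ _ uw))/=.
    by rewrite (last_ _ _ _ _ uw)/= (last_ _ _ _ _ uw).
  + by rewrite prob_follows_update ui mul1r.
- rewrite xk; case: (us) => n1 uE un.
  case xk1: (x k.+1) => [[[[e' []]|[s' t']]|s']|];
    rewrite ?(sum_matrix_no_exit hpar)//= ?eqxx//.
    have [ss|_] := eqVneq s s'; last by rewrite mul0r eqxx.
    subst s' => _; pose u' := update u m.+1 (Some (inr t')).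
    exists (follows M1 u' m.+1); split => //.
    + apply: (@phase_first _ _ n m.+1 u' s t') => //.
      * by rewrite kE addnS.
      * exact: leqW.
      * split => //; last by rewrite /u' updE.
        by move=> j nj; rewrite /u' updE ?uE//; lia.
      * by rewrite /u' updn.
      * move=> j; rewrite leq_eqVlt => /predU1P[->|ji]; first by rewrite /u' updn.
        by rewrite /u' updE// uN.
      * by move=> w uw; rewrite clockS (ck _ (sub _ _ _ _ uw))/= (last_ _ _ _ _ uw).
    + exact: sub.
    + move=> w uw; rewrite /= /sum_chain clockS (ck _ (sub _ _ _ _ uw))/=.
      by rewrite (last_ _ _ _ _ uw)/= (last_ _ _ _ _ uw) (sub _ _ _ _ uw _ nm) un.
    + by rewrite prob_follows_update ut mul1r.
  (* M1 terminates and the reading of M2 begins *)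
  have [ss|_] := eqVneq s s'; last by rewrite mul0r eqxx.
  subst s' => _; pose u' := update u m.+1 None.
  have us' : splits_at u' n s.
    split => //; last by rewrite /u' updE.
    by move=> j nj; rewrite /u' updE ?uE//; lia.
  exists (follows M1 u' m.+1 `&` follows2 n 0 (fun=> Some s)); split => //.
  + apply: (@phase_second _ _ n m.+1 0 u' s) => //.
    * by rewrite kE addnS addn0.
    * by rewrite /u' updn.
    * by move=> j jm; rewrite /u' updE// uN.
    * by move=> j; rewrite leqn0 => /eqP ->; rewrite addn0 addnS -kE.
    * by move=> w uw; rewrite clockS (ck _ (sub _ _ _ _ uw))/= (last_ _ _ _ _ uw)/= addn0.
  + by move=> w [/sub].
  + move=> w [uw /(_ 0%N isT)]; rewrite addn0 /= => M2n.
    rewrite /sum_chain clockS (ck _ (sub _ _ _ _ uw))/=.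
    by rewrite (last_ _ _ _ _ uw)/= M2n.
  + have [_ _ _ M2E] := hM; rewrite (M2E n m.+1 0 u' s (fun=> Some s))//;
      last exact: leqW.
    rewrite big_ord0 mule1 prob_follows_update ut mul1r /= big_sumType /=.
    by rewrite big1_eq add0r.
- have xk : x k = omap inr (y l) by rewrite kE xy.
  move=> tr.
  have [q xk1 tro] : exists2 q, x k.+1 = omap inr q &
      trans A (x k) (x k.+1) = trans Q2 (y l) q.
    have tot := sum_matrix_total hpar.
    move: tr; rewrite xk; case: (y l) => [t|]; case: (x k.+1) => [[[[]|]|t']|] /=;
      rewrite ?eqxx// => _.
    * by exists (Some t').
    * by exists None => //; exact: (congr1 (fun z => 1 - z) (tot (inr t))).
    * by exists None.
  rewrite tro xk1; pose y' := update y l.+1 q.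
  have f2 : follows2 n l.+1 y' `<=` follows2 n l y.
    by move=> w yw j jl; rewrite yw ?leqW// /y' updE.
  exists (follows M1 u m `&` follows2 n l.+1 y'); split.
  + apply: (@phase_second _ _ n m l.+1 u s y') => //.
    * by rewrite kE addnS.
    * move=> j; rewrite leq_eqVlt => /predU1P[->|jl]; first by rewrite /y' updn addnS -kE.
      by rewrite /y' updE// xy.
    * by move=> w uw; rewrite clockS ck//= addnS.
  + by move=> w [uw /f2].
  + move=> w [uw /(_ l.+1 (leqnn _))]; rewrite /y' updn addnS => M2w.
    by rewrite /= /sum_chain clockS ck//= M2w; case: (q).
  + have [_ _ _ M2E] := hM.
    rewrite (M2E n m l.+1 u s y' us (ltnW nm))// (M2E n m l u s y us (ltnW nm) y0).
    rewrite /y'; rewrite big_ord_recr/= updn updE// EFinM muleA; congr (_ * _%:E * _)%E.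
    by apply: eq_bigr => j _; rewrite !updE// ltnW.
Qed.

End Pathwise.
End SumChain.

(** * The law of the sum *)

Section AlmostEverywhere.
Context (d : measure_display) (T : measurableType d) (R : realType).
Variable Pr : probability T R.

Lemma ae_countable (I : countType) (Q : I -> T -> Prop) :
  (forall i, {ae Pr, forall w, Q i w}) -> {ae Pr, forall w, forall i, Q i w}.
Proof.
move=> aeQ.
have : {ae Pr, forall w, forall n, if unpickle n is Some i then Q i w else True}.
  apply: ae_foralln => n; case: (unpickle n) => [i|]; first exact: aeQ.
  exact: aeW.
by apply: filterS => w Qw i; have := Qw (pickle i); rewrite pickleK.
Qed.

Lemma ae_le_measure (A B : set T) : measurable A -> measurable B ->
  {ae Pr, forall w, A w -> B w} -> (Pr A <= Pr B)%E.
Proof.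
move=> mA mB [N [mN N0 sN]].
rewrite (@le_trans _ _ (Pr (B `|` N)))//.
  rewrite le_measure ?inE//; first exact: measurableU.
  by move=> w Aw; have [Bw|nBw] := pselect (B w); [left|right; apply: sN => /(_ Aw)].
apply: le_trans (measureU2 _ _ _) _ => //.
by move: N0 => /= ->; rewrite adde0.
Qed.

End AlmostEverywhere.

Section SumLaw.
Context (E S : finType).
Context (d : measure_display) (T : measurableType d) (R : realType).
Variables (Pr : probability T R).
Variables (alpha : E -> R) (P : E -> E -> R) (U : E -> S -> R) (Q1 Q2 : S -> S -> R).
Variables (M1 M2 : nat -> T -> option (E + S)).
Hypothesis hpar : CDPH_parameters alpha P U Q1 Q2.
Hypothesis hM : CDPH_construction Pr alpha P U Q1 Q2 M1 M2.
Local Notation A := (sum_matrix P U Q1 Q2).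
Local Notation M := (sum_chain M1 M2).

Let mM := measurable_sum_chain hM.

Lemma terminating_sum_chain : terminating_chain Pr (sum_vector alpha) A M.
Proof.
apply: terminating_chain_of_weight_le; first exact: mM.
- exact: probability_sum_vector hpar.
- exact: subprobability_sum_matrix hpar.
move=> x n /(sum_chain_event hpar hM)[H [ph HM <-]].
rewrite le_measure ?inE//.
  exact (measurable_phase hM ph).
by apply: measurable_follows; exact: mM.
Qed.

(** The event given by [sum_chain_event] is contained in the event that the
    trajectory is followed and has the same probability: they differ by a null
    set. *)
Lemma ae_sum_of_trajectory x k : x k = None ->
  (forall i, (1 <= i < k)%N -> x i != None) ->
  {ae Pr, forall w, follows M x k w ->
    (termination_time R M1 w + termination_time R M2 w = (k%:R)%:E)%E}.
Proof.
move=> xk xi.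
have mF : measurable (follows M x k) by apply: measurable_follows; exact: mM.
have PF := prob_follows x k terminating_sum_chain.
have [w0|/(sum_chain_event hpar hM)[H [ph HM PH]]] :=
  eqVneq (weight (sum_vector alpha) A x k) 0.
  exists (follows M x k); split => //; first by rewrite PF w0.
  by move=> w /= h; apply: contrapT => nF; apply: h => /nF.
have mH := measurable_phase hM ph.
exists (follows M x k `\` H); split.
- exact: measurableD.
- rewrite measureD//; last by rewrite -ge0_fin_numE// fin_num_measure.
  rewrite (setIidr HM).
  transitivity ((weight (sum_vector alpha) A x k)%:E -
      (weight (sum_vector alpha) A x k)%:E)%E; last by rewrite subee.
  by congr (_ - _)%E.
- move=> w /= h; apply: contrapT => nF; apply: h => Fw.
  have Hw : H w by apply: contrapT => nH; apply: nF.
  exact: (phase_termination hM ph Hw xk xi).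
Qed.

Lemma ae_termination_sum_chain : {ae Pr, forall w,
  termination_time R M w = (termination_time R M1 w + termination_time R M2 w)%E}.
Proof.
have fin := ae_termination (subprobability_sum_matrix hpar) terminating_sum_chain
  (sum_matrix_no_fixed_vector hpar).
(* Terminated trajectories are finite words, of which there are countably many. *)
have traj : {ae Pr, forall w, forall s : seq (option (sum_state E S)),
    nth None s (size s).-1 = None ->
    (forall i, (1 <= i < (size s).-1)%N -> nth None s i != None) ->
    follows M (nth None s) (size s).-1 w ->
    (termination_time R M1 w + termination_time R M2 w = ((size s).-1%:R)%:E)%E}.
  apply: ae_countable => s; set x := nth None s; set k := (size s).-1.
  have [xk|xk] := pselect (x k = None); last by apply: aeW.
  have [xi|xi] := pselect (forall i, (1 <= i < k)%N -> x i != None); last by apply: aeW.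
  by apply: filterS (ae_sum_of_trajectory xk xi) => w h _ _.
apply: filterS2 fin traj => w.
have := first_time_cases R M (fun o => o == None) w.
rewrite -/(termination_time R M) => -[[k [k1 /eqP Mk Mi ->]] _|[_ ->]//].
move=> /(_ (mkseq (M^~ w) k.+1)); rewrite size_mkseq -[k.+1.-1]/k => -> //.
- by rewrite nth_mkseq.
- by move=> i /andP[i1 ik]; rewrite nth_mkseq ?Mi ?i1// ltnW.
- by move=> i ik; rewrite nth_mkseq.
Qed.

End SumLaw.

Theorem proposition2p7 (R : realType) (E S : finType)
    (alpha : E -> R) (P : E -> E -> R) (U : E -> S -> R)
    (Q1 Q2 : S -> S -> R)
    (hpar : CDPH_parameters alpha P U Q1 Q2)
    (d : measure_display) (T : measurableType d) (Pr : probability T R)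
    (tau1 tau2 : {RV Pr >-> \bar R})
    (htau : is_CDPH alpha P U Q1 Q2
              (pushforward Pr (fun w : T => (tau1 w, tau2 w)))) :
  is_DPH (pushforward Pr (fun w : T => (tau1 w + tau2 w)%E)).
Proof.
case: htau => d' [T' [Pr' [M1 [M2 [hM law]]]]].
have tM := terminating_sum_chain hpar hM.
have sA := subprobability_sum_matrix hpar.
exists (sum_state E S), (sum_vector alpha), (sum_matrix P U Q1 Q2); split => //.
  exact: probability_sum_vector hpar.
exists d', T', Pr', (sum_chain M1 M2); split => //.
  exact: ae_termination sA tM (sum_matrix_no_fixed_vector hpar).
move=> B mB.
pose add := fun p : \bar R * \bar R => (p.1 + p.2)%E.
have madd : measurable_fun setT add.
  by apply: emeasurable_funD; [exact: measurable_fst|exact: measurable_snd].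
have mD : measurable (add @^-1` B) by rewrite -[X in measurable X]setTI; exact: madd.
(* The law of the pair is only known on measurable sets of pairs: the event on
   the sum is the preimage of one of them under the addition. *)
rewrite [LHS](law _ mD).
have mt1 : measurable_fun setT (termination_time R M1).
  by apply: measurable_termination_time => n o; case: hM => -[].
have mt2 : measurable_fun setT (termination_time R M2).
  by apply: measurable_termination_time => n o; case: hM.
have mt : measurable_fun setT (termination_time R (sum_chain M1 M2)).
  by apply: measurable_termination_time; exact: measurable_sum_chain hM.
have mA1 : measurable (
    (fun w => add (termination_time R M1 w, termination_time R M2 w)) @^-1` B).
  by rewrite -[X in measurable X]setTI; exact: (emeasurable_funD mt1 mt2).
have mA2 : measurable (termination_time R (sum_chain M1 M2) @^-1` B).
  by rewrite -[X in measurable X]setTI; exact: mt.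
have ae := ae_termination_sum_chain hpar hM.
apply/eqP; rewrite eq_le; apply/andP; split; apply: ae_le_measure => //;
  by apply: filterS ae => w; rewrite /preimage /add /= => ->.
Qed.
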